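(* If $F$ is a 3-resonant fullerene graph, then $|V(F)|\le 60$.
   Context: A fullerene graph is a 3-connected plane cubic graph with exactly 12 pentagonal faces and all other faces hexagonal. A set $\mathcal H$ of pairwise vertex-disjoint hexagonal faces is a resonant pattern if the graph has a perfect matching $M$ such that every hexagon in $\mathcal H$ is $M$-alternating (edges alternately in and off $M$), equivalently the graph minus all vertices of the hexagons in $\mathcal H$ has a perfect matching. A fullerene graph is $k$-resonant if every set of $i$ pairwise disjoint hexagons, for each $0\le i\le k$, is a resonant pattern. *)

(* Defs.v *)
From HB Require Import structures.
From mathcomp Require Import all_boot all_fingroup.

Set Implicit Arguments.
Unset Strict Implicit.
Unset Printing Implicit Defensive.

Record sgraph := SGraph {
  vertex :> finType;
  adj : rel vertex;
  adj_sym : symmetric adj;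
  adj_irrefl : irreflexive adj
}.

Definition cubic (G : sgraph) : Prop :=
  forall x : G, #|[set y | adj x y]| = 3.

Definition connected_on (G : sgraph) (A : {set G}) : Prop :=
  forall x y : G, x \in A -> y \in A ->
    connect [rel u v : G | [&& u \in A, v \in A & adj u v]] x y.

Definition k_connected (k : nat) (G : sgraph) : Prop :=
  k < #|G| /\ forall S : {set G}, #|S| < k -> connected_on (~: S).

Definition edges (G : sgraph) : {set {set G}} :=
  [set [set p.1; p.2] | p : G * G & adj p.1 p.2].

Definition perfect_matching (G : sgraph) (M : {set {set G}}) : Prop :=
  M \subset edges G /\ forall x : G, #|[set e in M | x \in e]| = 1.

(* A dart is an edge together with a direction, from its tail to its head. *)
Definition dart (G : sgraph) : finType := {p : G * G | adj p.1 p.2}.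

Definition dtail (G : sgraph) (d : dart G) : G := (val d).1.
Definition dhead (G : sgraph) (d : dart G) : G := (val d).2.
Definition dedge (G : sgraph) (d : dart G) : {set G} := [set dtail d; dhead d].

Lemma drev_subproof (G : sgraph) (d : dart G) : adj (dhead d) (dtail d).
Proof. by rewrite adj_sym; exact: (valP d). Qed.

Definition drev (G : sgraph) (d : dart G) : dart G :=
  exist (fun p : G * G => adj p.1 p.2) (dhead d, dtail d) (drev_subproof d).

Lemma drevK (G : sgraph) : involutive (@drev G).
Proof. by move=> d; apply: val_inj; case: d => -[]. Qed.

Definition face_perm (G : sgraph) (rot : {perm dart G}) : {perm dart G} :=
  perm (inj_comp (@perm_inj _ rot) (inv_inj (@drevK G))).

(* A plane graph is represented, up to homeomorphism of the sphere, by its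
   rotation system: rot d is the dart that follows d in the cyclic order around
   the tail of d, and the faces (the unbounded one included) are the orbits of
   face_perm rot, which sends a dart d to rot (drev d).  An orbit is the facial
   walk; its cardinal is the length of the walk.  Euler's formula says that the
   surface on which the rotation system embeds the graph is the sphere; in
   this form it is correct for connected graphs with at least one edge, which is
   what k_connected 1 provides. *)
Record plane_graph := PlaneGraph {
  pgraph :> sgraph;
  rot : {perm dart pgraph};
  rot_vertex :
    forall d : dart pgraph, porbit rot d = [set d' | dtail d' == dtail d];
  plane_connected : k_connected 1 pgraph;
  plane_euler :
    #|pgraph| + #|porbits (face_perm rot)| = #|edges pgraph| + 2
}.

Definition face_next (G : plane_graph) : {perm dart G} := face_perm (rot G).

Definition faces (G : plane_graph) : {set {set dart G}} :=
  porbits (face_next G).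

Definition face_vertices (G : plane_graph) (f : {set dart G}) : {set G} :=
  [set dtail d | d in f].

Definition pentagons (G : plane_graph) : {set {set dart G}} :=
  [set f in faces G | #|f| == 5].

Definition hexagons (G : plane_graph) : {set {set dart G}} :=
  [set f in faces G | #|f| == 6].

Definition fullerene (G : plane_graph) : Prop :=
  [/\ k_connected 3 G,
      cubic G,
      #|pentagons G| = 12
    & forall f, f \in faces G -> f \notin pentagons G -> f \in hexagons G].

Definition disjoint_hexagons (G : plane_graph) (H : {set {set dart G}}) : Prop :=
  H \subset hexagons G /\
  forall f g, f \in H -> g \in H -> f != g ->
    [disjoint face_vertices f & face_vertices g].

Definition alternating (G : plane_graph) (M : {set {set G}})
    (f : {set dart G}) : Prop :=
  forall d, d \in f -> (dedge (face_next G d) \in M) = (dedge d \notin M).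

Definition resonant_pattern (G : plane_graph) (H : {set {set dart G}}) : Prop :=
  disjoint_hexagons H /\
  exists2 M : {set {set G}}, perfect_matching M &
    forall f, f \in H -> alternating M f.

Definition k_resonant (k : nat) (G : plane_graph) : Prop :=
  forall (i : nat) (H : {set {set dart G}}),
    i <= k -> disjoint_hexagons H -> #|H| = i -> resonant_pattern H.

(* Main.v *)
Require Import Defs.
From mathcomp Require Import all_boot all_fingroup all_algebra zify.

Set Implicit Arguments.
Unset Strict Implicit.
Unset Printing Implicit Defensive.

(* Every vertex [v] is adjacent, along an edge not on that pentagon, to a vertex of
   some pentagon; as the 12 pentagons have 60 corners, there are at most 60
   vertices.  Indeed, consider the three faces that contain a neighbour of [v] but
   not [v].  If none is a pentagon and they are pairwise disjoint, then they are at
   most three disjoint hexagons whose removal isolates [v], against 3-resonance.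

   They are pairwise disjoint because two faces across edges at distance two of a
   face [f] that met would share an edge, and together with [f] they would give a
   cycle of length 3 in the dual, hence a 3-edge cut with two or more vertices on
   each side.  (That dual cycles are cuts is Euler's formula: over F_2 the
   orthogonal of the face boundaries has dimension |E| - |F| + 1 = |V| - 1, the
   dimension of the cut space.)  Such a cut cannot exist: the three faces that it
   crosses have together at most 18 corners, so at most 9 on one side [A]; removing
   from [A] the vertices on these faces leaves a smaller cut of the same kind, with
   equality throughout, and one concludes by infinite descent. *)

(** * Linear algebra: exactness from an Euler count *)

(** By the two kernel conditions, [m] and [n] have ranks at least |V| - 1 and |F| - 1. Hence the
    solutions [x] form a space of dimension at most |E| - |F| + 1 = |V| - 1; it contains the row
    space of [m], so the two coincide. *)
Lemma exact_of_euler (K : fieldType) (V E F : finType)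
    (m : V -> E -> K) (n : F -> E -> K) :
  (forall v f, \sum_e m v e * n f e = 0)%R ->
  (forall y : V -> K, (forall e, \sum_v y v * m v e = 0)%R -> forall u v, y u = y v) ->
  (forall y : F -> K, (forall e, \sum_f y f * n f e = 0)%R -> forall f g, y f = y g) ->
  #|V| + #|F| = #|E| + 2 ->
  forall x : E -> K, (forall f, \sum_e x e * n f e = 0)%R ->
  exists y : V -> K, forall e, x e = (\sum_v y v * m v e)%R.
Proof.
move=> mn kerm kern eul x xn.
have sumE (T : finType) (h : T -> K) :
    (\sum_(i < #|T|) h (enum_val i) = \sum_t h t)%R.
  by rewrite -(big_enum_val (A := T) h).
have rk (T : finType) (h : T -> E -> K) :
    (forall y : T -> K, (forall e, \sum_t y t * h t e = 0)%R -> forall s t, y s = y t) ->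
    #|T| <= (\rank (\matrix_(i < #|T|, j < #|E|) h (enum_val i) (enum_val j))%R).+1.
  move=> kerh; set H := (\matrix_(i, j) _)%R.
  have: \rank (kermx H) <= 1.
    apply: leq_trans (rank_leq_row (const_mx 1%R : 'M[K]_(1, #|T|))).
    apply: mxrankS; apply/row_subP => k.
    have yH : (row k (kermx H) *m H = 0)%R by apply/sub_kermxP; exact: row_sub.
    move: (row k _) yH => w yH.
    have yc : forall s t : T, w ord0 (enum_rank s) = w ord0 (enum_rank t).
      apply: kerh => e; move/rowP/(_ (enum_rank e)): yH; rewrite !mxE => yHe.
      rewrite -[RHS]yHe -sumE; apply: eq_bigr => i _.
      by rewrite !mxE enum_valK enum_rankK.
    case: (pickP (fun i : 'I_#|T| => true)) => [i0 _ | no]; last first.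
      suff -> : w = 0%R by exact: sub0mx.
      by apply/rowP => j; have := no j.
    apply/submxP; exists (w ord0 i0)%:M%R; apply/rowP => j.
    rewrite mul_scalar_mx !mxE GRing.mulr1.
    by have := yc (enum_val j) (enum_val i0); rewrite !enum_valK.
  by rewrite mxrank_ker leq_subLR addn1.
have := rk _ _ kerm; have := rk _ _ kern.
set N := (\matrix_(i, j) n _ _)%R; set M := (\matrix_(i, j) m _ _)%R => rN rM.
have MN : (M <= kermx N^T)%MS.
  apply/sub_kermxP/matrixP => i j; rewrite !mxE -[RHS](mn (enum_val i) (enum_val j)) -[RHS]sumE.
  by apply: eq_bigr => k _; rewrite !mxE.
have KM : (kermx N^T <= M)%MS.
  rewrite -(geq_leqif (mxrank_leqif_sup MN)) mxrank_ker mxrank_tr leq_subLR.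
  by rewrite -(leq_add2r 2) -eul addn2 -addSn -addnS addnC leq_add.
pose w := (\row_(j < #|E|) x (enum_val j))%R.
have : (w <= kermx N^T)%MS.
  apply/sub_kermxP/rowP => j; rewrite !mxE -[RHS](xn (enum_val j)) -[RHS]sumE.
  by apply: eq_bigr => k _; rewrite !mxE.
move/submx_trans => /(_ _ _ KM) /submxP [y wy].
exists (fun v => y ord0 (enum_rank v)) => e.
move/rowP/(_ (enum_rank e)): wy; rewrite !mxE enum_rankK => ->.
rewrite -[RHS]sumE; apply: eq_bigr => i _.
by rewrite !mxE enum_valK enum_rankK.
Qed.

(** * Plane graphs: even sets of dual edges are cuts *)

Section PlaneGraph.

Variable G : plane_graph.
Implicit Types (d e z : dart G) (v w : G) (A : {set G}) (X : {set dart G}).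

Definition face d : {set dart G} := porbit (face_next G) d.

Lemma face_nextE d : face_next G d = Defs.rot G (drev d).
Proof. by rewrite permE. Qed.

Lemma dtail_rev d : dtail (drev d) = dhead d. Proof. by []. Qed.

Lemma dhead_rev d : dhead (drev d) = dtail d. Proof. by []. Qed.

Lemma dtail_neq_head d : dtail d != dhead d.
Proof.
apply/negP => /eqP th; have := valP d; rewrite -/(dtail d) -/(dhead d) th.
by rewrite adj_irrefl.
Qed.

Lemma drev_neq d : drev d != d.
Proof. by apply: contraNneq (dtail_neq_head d) => {1}<-. Qed.

Lemma dart_eq d e : dtail d = dtail e -> dhead d = dhead e -> d = e.
Proof.
by case: d e => [[a b] h] [[a' b'] h']; rewrite /dtail /dhead /= => ? ?; apply: val_inj; congr pair.
Qed.

Lemma dedge_rev d : dedge (drev d) = dedge d.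
Proof. by rewrite /dedge setUC. Qed.

Lemma dedge_eq d e : dedge d = dedge e -> e = d \/ e = drev d.
Proof.
move=> de; have [] : dtail e \in dedge d /\ dhead e \in dedge d.
  by rewrite de !inE !eqxx orbT.
rewrite !inE; move=> /orP[] /eqP t /orP[] /eqP h.
- by have := dtail_neq_head e; rewrite t h eqxx.
- by left; apply: dart_eq.
- by right; apply: dart_eq.
- by have := dtail_neq_head e; rewrite t h eqxx.
Qed.

Lemma dedge_inj d e : dtail d = dtail e -> dedge d = dedge e -> d = e.
Proof.
move=> t /dedge_eq[-> //|er]; move: t (dtail_neq_head d).
by rewrite er dtail_rev => ->; rewrite eqxx.
Qed.

Lemma dtail_rot d : dtail (Defs.rot G d) = dtail d.
Proof.
by have := mem_porbit (Defs.rot G) 1 d; rewrite expg1 rot_vertex inE => /eqP.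
Qed.

Lemma dtail_face_next d : dtail (face_next G d) = dhead d.
Proof. by rewrite face_nextE dtail_rot. Qed.

Lemma face_self d : d \in face d.
Proof. exact: porbit_id. Qed.

Lemma face_faces d : face d \in faces G.
Proof. exact: imset_f. Qed.

Lemma face_ind (P : dart G -> Prop) d :
  P d -> (forall e, e \in face d -> P e -> P (face_next G e)) ->
  forall e, e \in face d -> P e.
Proof.
move=> Pd IH e /porbitP[i ->]; elim: i => [|i IHi]; first by rewrite expg0 perm1.
by rewrite expgSr permM; apply: IH => //; exact: mem_porbit.
Qed.

Lemma face_eqP d e : reflect (face d = face e) (d \in face e).
Proof. by rewrite /face -eq_porbit_mem; exact: eqP. Qed.

Lemma mem_faces (f : {set dart G}) d : f \in faces G -> (d \in f) = (f == face d).
Proof.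
by move=> /imsetP[e _ ->]; rewrite -/(face e) eq_sym; apply/face_eqP/eqP.
Qed.

Lemma face_face_next d : face (face_next G d) = face d.
Proof. by apply/face_eqP; have := mem_porbit (face_next G) 1 d; rewrite expg1. Qed.

Lemma face_rot d : face (Defs.rot G d) = face (drev d).
Proof. by rewrite -[d in LHS]drevK -face_nextE face_face_next. Qed.

Lemma graph_ind (P : G -> Prop) :
  (forall d, P (dtail d) -> P (dhead d)) -> forall u v, P u -> P v.
Proof.
move=> Pd u v Pu; have [_ /(_ set0)] := plane_connected G.
rewrite cards0 => /(_ isT u v); rewrite !inE => /(_ isT isT) /connectP[p].
elim: p u Pu => [|w p IH] u Pu /=; first by move=> _ ->.
case/andP=> /and3P[_ _ uw] pw lp; apply: IH pw lp.
exact: (Pd (exist (fun p : G * G => adj p.1 p.2) (u, w) uw)).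
Qed.

(** Picks one of the two darts of each edge, so that [E] enumerates the edges. *)
Let fdart d := enum_rank (dtail d) < enum_rank (dhead d).
Let E : finType := {d : dart G | fdart d}.
Let F : finType := {f : {set dart G} | f \in faces G}.

Let fdart_rev d : fdart (drev d) = ~~ fdart d.
Proof.
rewrite /fdart dtail_rev dhead_rev -leqNgt ltn_neqAle.
by rewrite (inj_eq val_inj) (inj_eq enum_rank_inj) eq_sym dtail_neq_head.
Qed.

Let card_E : #|E| = #|edges G|.
Proof.
rewrite card_sig; have <- : [set dedge d | d in fdart] = edges G.
  apply/setP=> s; apply/imsetP/imsetP => [[d _ ->]|[[u w] uw ->]].
    by exists (val d); first by rewrite inE; exact: (valP d).
  have {}uw : adj u w by move: uw; rewrite inE.
  pose d : dart G := exist (fun p : G * G => adj p.1 p.2) (u, w) uw.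
  case fd: (fdart d); first by exists d.
  exists (drev d); last by rewrite dedge_rev.
  exact: etrans (fdart_rev d) (congr1 negb fd).
rewrite card_in_imset // => d e fd fe /dedge_eq[->//|er].
have : fdart (drev d) by rewrite -er.
by rewrite fdart_rev (fd : fdart d).
Qed.

Local Open Scope ring_scope.

Let sumE (h : dart G -> 'F_2) :
  \sum_(e : E) (h (val e) + h (drev (val e))) = \sum_d h d.
Proof.
rewrite [RHS](bigID fdart) /= big_split /=; congr +%R.
  by rewrite -(big_sub fdart).
rewrite (reindex_inj (inv_inj (@drevK G))) /=.
rewrite [RHS](eq_bigl fdart); last by move=> d; rewrite fdart_rev negbK.
by rewrite -(big_sub fdart (fun d => h (drev d))).
Qed.

Let F2_cases (x : 'F_2) : {x = 0} + {x = 1}.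
Proof. by case: x => [[|[|n]] i] //; [left | right]; apply: val_inj. Qed.

Let addF2 (x : 'F_2) : x + x = 0.
Proof. by case: (F2_cases x) => ->; apply: val_inj. Qed.

Let addF2_eq (x y : 'F_2) : x + y = 0 -> x = y.
Proof. by move=> xy; rewrite -[y]GRing.add0r -(addF2 x) -GRing.addrA xy GRing.addr0. Qed.

(** Incidence over F_2; in [n], an edge with the same face on both sides gets 1 + 1 = 0. *)
Let m (v : G) (e : E) : 'F_2 :=
  (dtail (val e) == v)%:R + (dhead (val e) == v)%:R.
Let n (f : F) (e : E) : 'F_2 :=
  (val e \in val f)%:R + (drev (val e) \in val f)%:R.

(** A facial walk enters a vertex as often as it leaves it: after reindexing by [face_next] and by
    [drev], both halves of the sum count the darts of [f] with head [v]. *)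
Let mn v f : \sum_e m v e * n f e = 0.
Proof.
pose N d : 'F_2 := (d \in val f)%:R + (drev d \in val f)%:R.
pose h d := (dtail d == v)%:R * N d.
have -> : \sum_e m v e * n f e = \sum_d h d.
  rewrite -sumE; apply: eq_bigr => e _; rewrite /h /m GRing.mulrDl; congr (_ + _ * _).
  by rewrite /N drevK GRing.addrC.
rewrite (eq_bigr _ (fun d _ => GRing.mulrDr _ _ _)) big_split /=.
rewrite [X in _ + X](reindex_inj (inv_inj (@drevK G))) /=.
rewrite [X in X + _](reindex_inj (@perm_inj _ (face_next G))) /=.
rewrite -[RHS](addF2 (\sum_(d : dart G) (dhead d == v)%:R * (d \in val f)%:R)).
congr (_ + _); apply: eq_bigr => d _; last by rewrite drevK.
rewrite dtail_face_next; congr (_ * _%:R).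
by rewrite !mem_faces ?face_face_next //; exact: valP.
Qed.

(** The parity condition makes the edges of [X] orthogonal to all face boundaries over F_2. By
    exactness [X] is the coboundary of some [y], and [A] is the set where [y] is 1. *)
Lemma even_dual_is_cut X :
  (forall d, d \in X -> drev d \in X) ->
  (forall f, f \in faces G -> ~~ odd #|X :&: f|) ->
  exists A : {set G}, forall d, (d \in X) = (dtail d \in A) (+) (dhead d \in A).
Proof.
move=> Xrev Xev.
pose b2 (P : bool) : 'F_2 := P%:R.
have b2D P Q : b2 (P (+) Q) = b2 P + b2 Q by case: P Q => [] []; apply: val_inj.
have b2I : injective b2 by case=> [] [] // /(congr1 val).
have b2E (T : finType) (y : T -> 'F_2) t : \sum_u y u * b2 (t == u) = y t.
  rewrite (bigD1 t) //= eqxx GRing.mulr1 big1 ?GRing.addr0 // => u tu.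
  by rewrite eq_sym (negbTE tu) GRing.mulr0.
have ends (P : dart G -> Prop) : (forall d, P d -> P (drev d)) ->
    (forall e : E, P (val e)) -> forall d, P d.
  move=> Pr PE d; case fd: (fdart d); first exact: PE (Sub d fd).
  rewrite -[d]drevK; apply: Pr.
  have fr : fdart (drev d) by rewrite fdart_rev fd.
  exact: PE (Sub (drev d) fr).
have kerm (y : G -> 'F_2) :
    (forall e : E, \sum_v y v * m v e = 0) -> forall u v, y u = y v.
  move=> ym u v; apply: (graph_ind (P := fun v => y u = y v)) (erefl (y u)).
  move=> d ->; move: d; apply: ends => [d -> // | e].
  apply: addF2_eq; rewrite -[RHS](ym e).
  by rewrite [RHS](eq_bigr _ (fun v _ => GRing.mulrDr _ _ _)) big_split /= !b2E.
pose fc d : F := Sub (face d) (face_faces d).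
have nE (f : F) (e : E) : n f e = b2 (fc (val e) == f) + b2 (fc (drev (val e)) == f).
  by rewrite /n !(mem_faces _ (valP f)) ![fc _ == f]eq_sym.
have sum_n (y : F -> 'F_2) (e : E) :
    \sum_f y f * n f e = y (fc (val e)) + y (fc (drev (val e))).
  rewrite (eq_bigr _ (fun f _ => congr1 _ (nE f e))).
  by rewrite (eq_bigr _ (fun f _ => GRing.mulrDr _ _ _)) big_split /= !b2E.
(* The dual is connected because [G] is: [y] agrees on the two sides of an edge, hence on all faces
   around a vertex, hence at adjacent vertices. *)
have kern (y : F -> 'F_2) :
    (forall e : E, \sum_f y f * n f e = 0) -> forall f g, y f = y g.
  move=> yn.
  have yrev d : y (fc d) = y (fc (drev d)).
    move: d; apply: (ends (fun d => y (fc d) = y (fc (drev d)))) => [d yd|e].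
      by rewrite -yd drevK.
    by apply: addF2_eq; rewrite -sum_n.
  have yrot d : y (fc (Defs.rot G d)) = y (fc d).
    by rewrite [RHS]yrev; congr y; apply: val_inj; exact: face_rot.
  have ytail d e : dtail d = dtail e -> y (fc d) = y (fc e).
    move=> de; have : d \in porbit (Defs.rot G) e by rewrite rot_vertex inE de.
    case/porbitP => i ->; elim: i => [|i IHi]; first by rewrite expg0 perm1.
    by rewrite expgSr permM yrot.
  have yc d0 d : y (fc d) = y (fc d0).
    pose P v := forall d, dtail d = v -> y (fc d) = y (fc d0).
    suff PT : forall v, P v by exact: PT (erefl (dtail d)).
    move=> v; apply: (graph_ind (P := P) _ (u := dtail d0)); last by move=> e; exact: ytail.
    by move=> e Pe e' te'; rewrite (ytail e' (drev e)) // -yrev; exact: Pe.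
  have fcP (f : F) : exists d, f = fc d.
    by have /imsetP[d _ fd] := valP f; exists d; exact: val_inj.
  by move=> f g; have [[d ->] [e ->]] := (fcP f, fcP g).
have eul : (#|G| + #|F| = #|E| + 2)%N by rewrite card_E -plane_euler card_sig.
have Xn (f : F) : \sum_(e : E) b2 (val e \in X) * n f e = 0.
  have -> : \sum_(e : E) b2 (val e \in X) * n f e = \sum_d b2 (d \in X :&: val f).
    rewrite -sumE; apply: eq_bigr => e _; rewrite GRing.mulrDr !inE.
    have -> : (drev (val e) \in X) = (val e \in X).
      by apply/idP/idP => /Xrev; rewrite ?drevK.
    by rewrite -!GRing.natrM !mulnb.
  have -> : \sum_d b2 (d \in X :&: val f) = #|X :&: val f|%:R.
    rewrite -sum1_card GRing.natr_sum [RHS]big_mkcond.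
    by apply: eq_bigr => d _; case: (d \in _).
  have := Xev _ (valP f); rewrite -[in _%:R](odd_double_half #|_|) => /negbTE->.
  by rewrite add0n -muln2 mulnC GRing.natrM [2%:R](_ : _ = 0) ?GRing.mul0r //; apply: val_inj.
have [y Xy] := exact_of_euler mn kerm kern eul Xn.
exists [set v | y v == 1].
have y1 v : y v = b2 (v \in [set v | y v == 1]).
  by rewrite inE; case: (F2_cases (y v)) => ->; apply: val_inj.
apply: ends => [d|e].
  by rewrite dtail_rev dhead_rev addbC => <-; apply/idP/idP => /Xrev; rewrite ?drevK.
apply: b2I; rewrite b2D -!y1 Xy.
by rewrite (eq_bigr _ (fun v _ => GRing.mulrDr _ _ _)) big_split /= !b2E.
Qed.
End PlaneGraph.

(** * Cubic 3-connected plane graphs: small cuts and incidences of faces *)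

Section CubicPlaneGraph.

Variable G : plane_graph.
Hypothesis cubicG : cubic G.
Hypothesis connG : k_connected 3 G.
Implicit Types (d e z : dart G) (v w : G) (A : {set G}) (X : {set dart G}).

Local Notation r := (Defs.rot G).
Local Notation phi := (face_next G).

Lemma card_darts_at v : #|[set d : dart G | dtail d == v]| = 3.
Proof.
rewrite -(cubicG v) -(card_in_imset (f := @dhead G)); last first.
  by move=> d e; rewrite !inE => /eqP dv /eqP ev /dart_eq; apply; rewrite dv.
apply: eq_card => w; rewrite inE; apply/imsetP/idP => [[d]|vw].
  by rewrite inE => /eqP <- ->; exact: (valP d).
by exists (exist (fun p : G * G => adj p.1 p.2) (v, w) vw); rewrite ?inE.
Qed.

Lemma porbit_rot d : porbit r d =i [:: d; r d; r (r d)].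
Proof. by move=> e; rewrite porbit_traject rot_vertex card_darts_at. Qed.

Lemma uniq_rot d : uniq [:: d; r d; r (r d)].
Proof. by have := uniq_traject_porbit r d; rewrite rot_vertex card_darts_at. Qed.

Lemma rot_neq d : r d != d.
Proof. by have := uniq_rot d; rewrite /= !inE negb_or eq_sym; case/andP=> /andP[]. Qed.

Lemma rot2_neq d : r (r d) != d.
Proof.
by have := uniq_rot d; rewrite /= !inE negb_or (eq_sym d (r (r d))); case/andP=> /andP[].
Qed.

Lemma rot3 d : r (r (r d)) = d.
Proof. by have := iter_porbit r d; rewrite rot_vertex card_darts_at. Qed.

Lemma dtail_eqP d e : dtail e = dtail d -> [\/ e = d, e = r d | e = r (r d)].
Proof.
move=> ed; have : e \in porbit r d by rewrite rot_vertex inE ed.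
rewrite porbit_rot !inE => /or3P[] /eqP ->; by [constructor 1 | constructor 2 | constructor 3].
Qed.

Lemma dart_at v : exists d, dtail d = v.
Proof.
have /card_gt0P[d] : 0 < #|[set d : dart G | dtail d == v]| by rewrite card_darts_at.
by rewrite inE => /eqP; exists d.
Qed.

Lemma card_darts_in A : #|[set d : dart G | dtail d \in A]| = 3 * #|A|.
Proof.
rewrite -sum1_card (partition_big (@dtail G) (mem A)) /= => [|d]; last by rewrite inE.
rewrite (eq_bigr (fun=> 3)) => [|v vA]; first by rewrite sum_nat_const mulnC.
rewrite -(card_darts_at v) -sum1_card; apply: eq_bigl => d; rewrite !inE.
by case: eqP => [->|]; rewrite ?vA ?andbF.
Qed.

Definition outd A := [set d : dart G | (dtail d \in A) && (dhead d \notin A)].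

Lemma outdC A : outd (~: A) = @drev G @: outd A.
Proof.
apply/setP => d; apply/idP/imsetP => [|[e]]; rewrite !inE.
  by rewrite negbK => /andP[h t]; exists (drev d); rewrite ?drevK // !inE dtail_rev dhead_rev h t.
by move=> /andP[h t] ->; rewrite dtail_rev dhead_rev h t.
Qed.

Lemma card_outdC A : #|outd (~: A)| = #|outd A|.
Proof. by rewrite outdC card_imset //; exact: inv_inj (@drevK G). Qed.

Lemma card_cut X A : (forall d, (d \in X) = (dtail d \in A) (+) (dhead d \in A)) ->
  #|X| = 2 * #|outd A|.
Proof.
move=> XA; rewrite mul2n -addnn -{2}card_outdC -cardsUI.
rewrite (_ : outd A :&: _ = set0) ?cards0 ?addn0; last first.
  by apply/setP => d; rewrite !inE; case: (dtail d \in A); rewrite ?andbF.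
by apply: eq_card => d; rewrite XA !inE; case: (dtail d \in A); case: (dhead d \in A).
Qed.

(* Removing the tails of the darts leaving [A] disconnects [G], unless [A] has at
   most two vertices, and then at least three darts leave [A]. *)
Lemma small_cut A : #|outd A| <= 2 -> A = set0 \/ A = setT.
Proof.
move=> A2; case: (set_0Vmem A) => [|[u0 u0A]]; first by left.
case: (set_0Vmem (~: A)) => [A0|[w wA]]; first by right; rewrite -[A]setCK A0 setC0.
exfalso; pose S := [set dtail d | d in outd A].
have S2 : #|S| <= 2 by apply: leq_trans A2; exact: leq_imset_card.
have SA : S \subset A by apply/subsetP => _ /imsetP[d + ->]; rewrite inE => /andP[].
case: (boolP (A \subset S)) => [/subset_leq_card AS|/subsetPn[u uA uS]]; last first.
  have [_ /(_ S S2) /(_ u w)] := connG; rewrite !inE uS => /(_ isT).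
  have wS : w \notin S by apply: contraTN wA => /(subsetP SA); rewrite inE negbK.
  case/(_ wS)/connectP=> p; elim: p u uA {uS} => [|v p IH] u uA /=.
    by move=> _ wu; move: wA; rewrite inE wu uA.
  case/andP=> /and3P[uS _ uv] pv lp; apply: IH pv lp.
  apply: contraTT uS => vA; rewrite inE negbK.
  apply/imsetP; exists (exist (fun p : G * G => adj p.1 p.2) (u, v) uv) => //.
  by rewrite inE /dtail /dhead /= uA.
pose B := [set d : dart G | (dtail d \in A) && (dhead d \in A)].
have cB : #|outd A| + #|B| = 3 * #|A|.
  rewrite -card_darts_in -cardsUI (_ : _ :&: _ = set0) ?cards0 ?addn0.
    by apply: eq_card => d; rewrite !inE -andb_orr; case: (dhead d \in A); rewrite ?andbT ?andbF.
  by apply/setP=> d; rewrite !inE; case: (dhead d \in A); rewrite ?andbT ?andbF.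
(* As [G] is simple, the darts inside [A] are distinct off-diagonal pairs. With a = |A| equal to 1
   or 2, at least 3a - a(a - 1) >= 3 darts then leave [A]. *)
have : #|B| + #|A| <= #|A| * #|A|.
  rewrite -cardsX -(card_imset B val_inj) -(card_imset A (f := fun a => (a, a))) => [|a b []//].
  rewrite -cardsUI (_ : _ :&: _ = set0) ?cards0 ?addn0.
    apply/subset_leq_card/subsetP=> p; rewrite !inE => /orP[/imsetP[d dB ->]|/imsetP[a aA ->]].
      by move: dB; rewrite inE.
    by rewrite /= aA.
  apply/setP => p; rewrite !inE; apply/negP => /andP[/imsetP[d _ ->] /imsetP[a _ da]].
  by have := dtail_neq_head d; rewrite /dtail /dhead da eqxx.
have A0 : 0 < #|A| by apply/card_gt0P; exists u0.
move: cB A0 A2 (leq_trans AS S2).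
by case: #|A| => [|[|[|k]]] //; lia.
Qed.

(** Four darts closed under reversal are two edges, too few for a cut with both sides nonempty. *)
Lemma dual_cycle_nil X :
  (forall d, d \in X -> drev d \in X) ->
  (forall f, f \in faces G -> ~~ odd #|X :&: f|) ->
  #|X| <= 4 -> X = set0.
Proof.
move=> Xr Xf X4; have [A XA] := even_dual_is_cut Xr Xf.
have : #|outd A| <= 2 by rewrite -(leq_pmul2l (m := 2)) // -(card_cut XA).
by case/small_cut => A0; apply/setP => d; rewrite XA A0 !inE.
Qed.

(** Reduces the parity condition on a dual cycle to counting in an explicit list of faces. *)
Lemma card_seq_face (s : seq (dart G)) (f : {set dart G}) : uniq s -> f \in faces G ->
  #|[set d in s] :&: f| = count (pred1 f) (map (@face G) s).
Proof.
move=> us ff; rewrite count_map -size_filter -(card_uniqP (filter_uniq _ us)).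
by apply: eq_card => d; rewrite !inE mem_filter andbC (mem_faces _ ff) /= eq_sym.
Qed.

(** Otherwise this edge alone would meet every face evenly, and so be a bridge. *)
Lemma face_rev_neq d : face d != face (drev d).
Proof.
apply/eqP => dd; suff /setP/(_ d) : [set d; drev d] = set0 by rewrite !inE eqxx.
apply: dual_cycle_nil => [e|f ff|]; last by rewrite cards2; case: (_ != _).
  by rewrite !inE => /orP[] /eqP ->; rewrite ?drevK eqxx ?orbT.
have -> : [set d; drev d] = [set e in [:: d; drev d]] by apply/setP => e; rewrite !inE.
rewrite card_seq_face //=; first by rewrite dd; case: (_ == _).
by rewrite inE eq_sym drev_neq.
Qed.

(* Two edges shared by two faces would form a 2-edge cut. *)
Lemma face_pair_inj d e :
  face d = face e -> face (drev d) = face (drev e) -> d = e.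
Proof.
move=> de rde; apply: contraTeq isT => nde; exfalso.
have us : uniq [:: d; drev d; e; drev e].
  have ne x y : face x != face y -> x != y by apply: contraNneq => ->.
  rewrite /= !inE !negb_or nde (inj_eq (inv_inj (@drevK G))) nde.
  by rewrite !ne -?de -?rde ?face_rev_neq // eq_sym face_rev_neq.
suff /setP/(_ d) : [set x in [:: d; drev d; e; drev e]] = set0 by rewrite !inE eqxx.
apply: dual_cycle_nil => [x|f ff|]; last by rewrite cardsE (card_uniqP us).
  by rewrite !inE => /or4P[] /eqP ->; rewrite ?drevK eqxx ?orbT.
rewrite card_seq_face //= -de -rde.
by do 2!case: (_ == f).
Qed.

Lemma face_set2_inj d e : [set face d; face (drev d)] = [set face e; face (drev e)] ->
  e = d \/ e = drev d.
Proof.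
move=> de; have nd := face_rev_neq e.
have : (face e \in [set face d; face (drev d)]) && (face (drev e) \in [set face d; face (drev d)]).
  by rewrite de !inE !eqxx orbT.
rewrite !inE => /andP[/orP[]/eqP h1 /orP[]/eqP h2].
- by rewrite h1 h2 eqxx in nd.
- by left; apply: face_pair_inj.
- by right; apply: face_pair_inj; rewrite ?drevK.
- by rewrite h1 h2 eqxx in nd.
Qed.

Lemma face_rot_neq d : face (r d) != face d.
Proof. by rewrite face_rot eq_sym face_rev_neq. Qed.

(** Any two darts at a vertex are consecutive in a rotation of order three, so their faces are the
    two sides of an edge. *)
Lemma face_tail_inj d e : face d = face e -> dtail d = dtail e -> d = e.
Proof.
move=> fde /esym/dtail_eqP[-> // | er | er].
  by have := face_rot_neq d; rewrite -er -fde eqxx.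
by have := face_rot_neq e; rewrite er rot3 -er fde eqxx.
Qed.

End CubicPlaneGraph.

(** * Nontrivial 3-edge cuts when all faces have length 5 or 6 *)

Section CyclicCuts.

Variable G : plane_graph.
Hypothesis cubicG : cubic G.
Hypothesis connG : k_connected 3 G.
Hypothesis face_ge5 : forall d : dart G, 5 <= #|face d|.
Hypothesis face_le6 : forall d : dart G, #|face d| <= 6.
Implicit Types (d e z c : dart G) (v w : G) (A : {set G}) (X : {set dart G}).

Local Notation r := (Defs.rot G).
Local Notation phi := (face_next G).

(** The corners of the faces crossed by the cut around [A]; a dart stands for the corner of its face
    at its tail. *)
Definition ringd A := [set d : dart G | face d \in [set face c | c in outd A]].

Lemma mem_ringd A d e : face d = face e -> (d \in ringd A) = (e \in ringd A).
Proof. by rewrite !inE => ->. Qed.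

Lemma outd_ringd A : outd A \subset ringd A.
Proof. by apply/subsetP => d dA; rewrite inE imset_f. Qed.

Lemma inner_face A d : d \notin ringd A -> dtail d \in A ->
  forall e, e \in face d -> dtail e \in A.
Proof.
move=> dR dA; apply: (face_ind (P := fun e => dtail e \in A)) => // e /face_eqP ed eA.
rewrite dtail_face_next; apply: contraNT dR => hA.
by rewrite -(mem_ringd _ ed); apply: (subsetP (outd_ringd A)); rewrite inE eA.
Qed.

(** The facial walk through [drev d] enters [A], so it must also leave it. *)
Lemma outd_rev_ringd A d : d \in outd A -> drev d \in ringd A.
Proof.
move=> dA; move: (dA); rewrite inE => /andP[tA hA]; apply: contraR hA => dR.
apply: (inner_face (A := A) (d := phi (drev d)) _ _ (e := drev d)).
- by rewrite (mem_ringd _ (face_face_next _)).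
- by rewrite dtail_face_next.
- by apply/face_eqP; rewrite face_face_next.
Qed.

Lemma card_ringd A : #|ringd A| <= 6 * #|outd A|.
Proof.
have sR : ringd A \subset cover [set face c | c in outd A].
  by apply/subsetP => d; rewrite inE => dQ; apply/bigcupP; exists (face d); rewrite ?face_self.
apply: leq_trans (subset_leq_card sR) _; apply: leq_trans (leq_card_cover _) _.
apply: (@leq_trans (\sum_(f in [set face c | c in outd A]) 6)).
  by apply: leq_sum => _ /imsetP[c _ ->]; exact: face_le6.
by rewrite sum_nat_const mulnC leq_mul2l leq_imset_card.
Qed.

Lemma ringdC A : ringd (~: A) = ringd A.
Proof.
have sub B : ringd (~: B) \subset ringd B.
  apply/subsetP => d; rewrite inE outdC => /imsetP[_ /imsetP[c cB ->] dc].
  by rewrite (mem_ringd _ dc) outd_rev_ringd.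
by apply/eqP; rewrite eqEsubset sub -{1}[A]setCK sub.
Qed.

(** The size conditions exclude the three edges at a single vertex. *)
Definition cut3 A := [/\ #|outd A| = 3, 1 < #|A| & 1 < #|~: A|].

(** The three crossing edges separate three different pairs of crossed faces. There are at most
    three crossed faces, hence no further pair, and a pair of faces determines the edge between
    them. *)
Lemma ringd_both A d : #|outd A| = 3 -> d \in ringd A -> drev d \in ringd A ->
  d \in outd A \/ drev d \in outd A.
Proof.
move=> A3; rewrite ![_ \in ringd A]inE => dR rR; pose Q := [set face c | c in outd A].
pose f c := [set face c; face (drev c)].
have fQ c : face c \in Q -> face (drev c) \in Q ->
    f c \in [set B : {set {set dart G}} | B \subset Q & #|B| == 2].
  by move=> cQ rcQ; rewrite inE subUset !sub1set cQ rcQ cards2 face_rev_neq.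
have /eqP fC : f @: outd A == [set B : {set {set dart G}} | B \subset Q & #|B| == 2].
  rewrite eqEcard; apply/andP; split.
    apply/subsetP => _ /imsetP[c cA ->]; apply: fQ; first exact: imset_f.
    by have := outd_rev_ringd cA; rewrite inE.
  have Q3 : #|Q| <= 3 by rewrite -A3 leq_imset_card.
  rewrite cards_draws card_in_imset ?A3 ?(leq_trans (leq_bin2l 2 Q3)) //.
  move=> c c' cA cA' /(face_set2_inj cubicG connG)[] // c'c.
  by move: cA cA'; rewrite c'c !inE dhead_rev dtail_rev => /andP[-> _] /andP[_].
have := fQ d dR rR; rewrite -fC => /imsetP[c cA /(face_set2_inj cubicG connG)[] cd].
  by left; rewrite -cd.
by right; rewrite -cd.
Qed.

Lemma ringd_rot A d : #|outd A| = 3 -> dtail d \in A ->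
  d \in ringd A -> r d \in ringd A -> d \in outd A.
Proof.
move=> A3 dA dR; rewrite (mem_ringd _ (face_rot d)) => rR.
by case: (ringd_both A3 dR rR) => //; rewrite !inE dhead_rev dA andbF.
Qed.

(** Moving a shared end [v] to the other side would replace two crossing edges by the third edge at
    [v], leaving a cut of at most two edges with both sides nonempty. *)
Lemma outd_tail_inj A c d : cut3 A -> c \in outd A -> d \in outd A ->
  dtail c = dtail d -> c = d.
Proof.
case=> A3 A1 _ cA dA cd; apply/eqP/negPn/negP => ncd.
pose v := dtail c; pose at_v := [set e : dart G | dtail e == v].
have sub : outd (A :\ v) \subset
    (outd A :\: [set c; d]) :|: @drev G @: (at_v :\: [set c; d]).
  apply/subsetP => e; rewrite !inE negb_and negbK => /andP[/andP[tv tA] /orP[/eqP hv|hA]].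
    apply/orP; right; apply/imsetP; exists (drev e); rewrite ?drevK // !inE dtail_rev hv eqxx andbT.
    by apply/norP; split; apply: contraTneq tA => ed;
      [move: cA | move: dA]; rewrite -ed inE dhead_rev => /andP[].
  apply/orP; left; rewrite tA hA !andbT.
  by apply/norP; split; apply: contraNneq tv => ->; rewrite /v ?cd.
have cd2 (Y : {set dart G}) : #|Y| = 3 -> c \in Y -> d \in Y -> #|Y :\: [set c; d]| = 1.
  move=> Y3 cY dY; rewrite cardsD Y3 (setIidPr _) ?cards2 ?ncd //.
  by rewrite subUset !sub1set cY.
have : #|outd (A :\ v)| <= 2.
  apply: leq_trans (subset_leq_card sub) _; apply: leq_trans (leq_card_setU _ _) _.
  rewrite (card_imset _ (inv_inj (@drevK G))) (cd2 _ A3 cA dA) cd2 //; first exact: card_darts_at.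
    by rewrite inE.
  by rewrite inE /v cd.
have vA : v \in A by move: cA; rewrite inE => /andP[].
case/(small_cut cubicG connG) => /setP Av; last by have := Av v; rewrite !inE eqxx.
by have := cardsD1 v A; rewrite vA (_ : A :\ v = set0) ?cards0; [lia | apply/setP].
Qed.

Lemma card_inner_faces (J : {set dart G}) (s : seq (dart G)) :
  uniq (map (@face G) s) -> (forall d, d \in s -> face d \subset J) -> 5 * size s <= #|J|.
Proof.
move=> us sJ; pose K := [set e | face e \in map (@face G) s].
apply: (@leq_trans #|K|); last first.
  apply/subset_leq_card/subsetP => e; rewrite inE => /mapP[d ds ed].
  by apply: (subsetP (sJ d ds)); apply/face_eqP.
rewrite {}/K; elim: s us {sJ} => [|d s IH] //= /andP[ds us].
rewrite mulnS; apply: leq_trans (leq_add (face_ge5 d) (IH us)) _.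
rewrite -cardsUI (_ : _ :&: _ = set0) ?cards0 ?addn0.
  apply/subset_leq_card/subsetP => e; rewrite !inE => /orP[/face_eqP ->|->]; by rewrite ?eqxx ?orbT.
apply/setP => e; rewrite !inE; apply/negP => /andP[/face_eqP -> ]; exact: negP.
Qed.

(* [B] is [A] without its vertices on the crossing faces, [I] is the set of corners
   of the faces inside [A].  The ends in [A] of the three crossing edges carry six
   crossing corners; [W] is the set of the others, and each dart leaving [B] points
   to its own element of [W].  If [B] had at most one vertex, [I] would be too small
   for the number of distinct faces meeting at a vertex inside [A]. *)
Lemma cut3_peel A : cut3 A ->
  #|[set d in ringd A | dtail d \in A]| <= 9 ->
  #|[set d in ringd A | dtail d \in A]| = 9 /\ exists2 B, cut3 B & #|B| < #|A|.
Proof.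
move=> cA; have [A3 A1 AC1] := cA.
set R := ringd A; set C := outd A; set RA := [set d in R | _].
pose W := RA :\: (C :|: r @: C).
pose B := [set v in A | [forall d : dart G, (dtail d == v) ==> (d \notin R)]].
pose I := [set d : dart G | (dtail d \in A) && (d \notin R)].
have BP v : reflect (v \in A /\ forall d, dtail d = v -> d \notin R) (v \in B).
  rewrite inE; apply: (iffP andP) => [[vA /forallP vB]|[vA vB]]; split=> //.
    by move=> d dv; have := vB d; rewrite dv eqxx.
  by apply/forallP => d; apply/implyP => /eqP; exact: vB.
have RAE d : (d \in RA) = (d \in R) && (dtail d \in A) by rewrite inE.
have IE d : (d \in I) = (dtail d \in A) && (d \notin R) by rewrite inE.
have CR c : c \in C -> c \in R by apply: (subsetP (outd_ringd A)).
have CA c : c \in C -> dtail c \in A by rewrite inE => /andP[].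
have rCR c : c \in C -> r c \in R by move=> cC; rewrite (mem_ringd _ (face_rot c)) outd_rev_ringd.
have RC d : d \in R -> r d \in R -> dtail d \in A -> d \in C.
  by move=> dR rR tA; apply: ringd_rot.
have C3 : #|C| = 3 := A3.
have cardRA : #|RA| = 6 + #|W|.
  have sCR : C :|: r @: C \subset RA.
    rewrite subUset; apply/andP; split; apply/subsetP => d.
      by move=> dC; rewrite RAE CR //= CA.
    by case/imsetP=> c cC ->; rewrite RAE rCR //= dtail_rot CA.
  have dis : C :&: r @: C = set0.
    apply/setP => d; rewrite inE [RHS]inE; apply/negP => /andP[dC /imsetP[c cC dc]].
    have := outd_tail_inj cA dC cC; rewrite dc dtail_rot => /(_ erefl) /eqP.
    by rewrite (negbTE (rot_neq cubicG c)).
  rewrite -(cardsID (C :|: r @: C) RA) (setIidPr sCR) cardsU dis cards0 subn0.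
  by rewrite (card_imset _ perm_inj) C3.
(* At the head of [d], two corners lie on the faces beside [d], which are not crossed since they
   contain a vertex of [B]. The head is not in [B], so its third corner is the crossed one. *)
have outB : #|outd B| <= #|W|.
  rewrite -(card_imset (f := fun d => r (r (drev d)))); last first.
    by move=> d e /perm_inj /perm_inj /(inv_inj (@drevK G)).
  apply/subset_leq_card/subsetP => _ /imsetP[d + ->].
  rewrite inE => /andP[/BP[tA tB] hB].
  have dR := tB d erefl; have rdR := tB (r d) (dtail_rot d).
  have hA : dhead d \in A by apply: contraNT dR => hA; apply: CR; rewrite inE tA.
  have eR : drev d \notin R by rewrite -(mem_ringd _ (face_rot d)).
  have reR : r (drev d) \notin R by rewrite -face_nextE (mem_ringd _ (face_face_next d)).
  have rreR : r (r (drev d)) \in R.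
    apply: contraNT hB => rreR; apply/BP; split=> // z zd.
    by case: (dtail_eqP cubicG (d := drev d) zd) => ->.
  rewrite in_setD RAE rreR !dtail_rot hA !andbT in_setU; apply/norP; split.
    by apply: contraNN eR => /rCR; rewrite rot3.
  by apply: contraNN reR => /imsetP[c cC /perm_inj ->]; exact: CR.
have cardA : #|A| <= 3 + #|W| + #|B|.
  have sA : A \subset ([set dtail d | d in C] :|: [set dtail d | d in W]) :|: B.
    apply/subsetP => v vA; rewrite !in_setU; case vB: (v \in B); rewrite ?orbT // orbF.
    have [d dv dR] : exists2 d : dart G, dtail d = v & d \in R.
      move: vB; rewrite inE vA => /negbT/forallPn[d]; rewrite negb_imply negbK => /andP[/eqP dv dR].
      by exists d.
    case dC: (d \in C); first by rewrite -dv imset_f.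
    case drC: (d \in r @: C).
      by move/imsetP: drC => [c cC dc]; rewrite -dv dc dtail_rot imset_f.
    by rewrite -dv orbC imset_f // in_setD in_setU RAE dR dv vA dC drC.
  apply: leq_trans (subset_leq_card sA) _; apply: leq_trans (leq_card_setU _ _) _.
  rewrite leq_add2r; apply: leq_trans (leq_card_setU _ _) _.
  by apply: leq_add; rewrite -?A3; exact: leq_imset_card.
have cardI : #|I| + #|RA| = 3 * #|A|.
  rewrite -(card_darts_in cubicG) -cardsUI (_ : _ :&: _ = set0) ?cards0 ?addn0.
    apply: eq_card => d; rewrite in_setU IE RAE in_set.
    by case: (d \in R); case: (dtail d \in A).
  apply/setP => d; rewrite in_setI IE RAE in_set0.
  by case: (d \in R); rewrite ?andbF.
have IF d : d \in I -> face d \subset I.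
  rewrite IE => /andP[tA dR]; apply/subsetP => e ed; rewrite IE (inner_face dR) //=.
  by move/face_eqP: ed => ed; rewrite (mem_ringd _ ed).
(* The counts give |I| <= 3 + 2|W| + 3|B|. This is at most 3 if [B] and [W] are empty, 9 if only [B]
   is, and 12 if |B| = 1, whereas one, two or three inner faces, respectively, need 5, 10 or 15
   corners. *)
move=> RA9; rewrite cardRA; have W3 : #|W| <= 3 by lia.
have nB0 : #|B| != 0.
  apply/eqP => B0; case: (set_0Vmem W) => [W0|[z]].
    have /card_gt0P[c cC] : 0 < #|C| by rewrite A3.
    have cI : r (r c) \in I.
      rewrite IE !dtail_rot CA //=; apply/negP => cR.
      have := RC _ cR; rewrite rot3 // !dtail_rot => /(_ (CR _ cC) (CA _ cC)) cC2.
      have := outd_tail_inj cA cC2 cC; rewrite !dtail_rot => /(_ erefl) /eqP.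
      by rewrite (negbTE (rot2_neq cubicG c)).
    have I5 : 5 * 1 <= #|I|.
      apply: (@card_inner_faces I [:: r (r c)]) => // d.
      by rewrite inE => /eqP ->; exact: IF.
    have W0' : #|W| = 0 by rewrite W0 cards0.
    lia.
  rewrite in_setD in_setU RAE => /andP[/norP[zC zrC] /andP[zR zA]].
  have rzR : r z \notin R by apply: contraNN zC => rzR; exact: RC.
  have rrzR : r (r z) \notin R.
    apply: contraNN zrC => rrzR; apply/imsetP; exists (r (r z)); rewrite ?rot3 //.
    by apply: RC; rewrite ?rot3 // !dtail_rot.
  have : 5 * 2 <= #|I|.
    apply: (@card_inner_faces I [:: r z; r (r z)]) => [|d].
      by rewrite /= inE eq_sym face_rot_neq.
    by rewrite !inE => /orP[] /eqP ->; apply: IF; rewrite IE !dtail_rot zA.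
  lia.
have nB1 : #|B| != 1.
  apply/eqP => B1; have /card_gt0P[v /BP[vA vB]] : 0 < #|B| by rewrite B1.
  have [d dv] := dart_at cubicG v.
  have : 5 * 3 <= #|I|.
    apply: (@card_inner_faces I [:: d; r d; r (r d)]) => [|e].
      have h1 := face_rot_neq cubicG connG d; have h2 := face_rot_neq cubicG connG (r d).
      have := face_rot_neq cubicG connG (r (r d)); rewrite rot3 // => h3.
      by rewrite /= !inE negb_or h3 eq_sym h1 eq_sym h2.
    by rewrite !inE => /or3P[] /eqP ->; apply: IF; rewrite IE ?dtail_rot dv vA vB /= ?dtail_rot.
  lia.
have sBA : B \subset A by apply/subsetP => v /BP[].
have BC1 : 1 < #|~: B| by apply: leq_trans AC1 (subset_leq_card _); rewrite setCS.
have nB2 : ~~ (#|outd B| <= 2).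
  apply/negP => /(small_cut cubicG connG)[] BE; first by rewrite BE cards0 in nB0.
  by rewrite BE setCT cards0 in BC1.
(* Now 3 <= |outd B| <= |W| <= 3. *)
split; first lia.
exists B; first by split=> //; lia.
have /card_gt0P[c cC] : 0 < #|C| by rewrite C3.
apply: proper_card; apply/properP; split=> //; exists (dtail c); first exact: CA.
by apply/negP => /BP[_ /(_ c erefl)]; rewrite CR.
Qed.

Lemma cut3C A : cut3 A -> cut3 (~: A).
Proof. by case=> A3 A1 AC1; split; rewrite ?card_outdC ?setCK. Qed.

(** If at most 9 of the at most 18 crossed corners lie in [A], peeling gives a smaller cut.
    Otherwise at most 8 lie on the other side, where peeling forces exactly 9; so the descent never
    changes sides. *)
Lemma no_cut3 A : ~ cut3 A.
Proof.
have [k] := ubnP #|A|; elim: k A => // k IH A; rewrite ltnS => Ak cA.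
pose c B := #|[set d in ringd B | dtail d \in B]|.
have cAC : c A + c (~: A) <= 18.
  have [A3 _ _] := cA; have := card_ringd A; rewrite A3; apply: leq_trans.
  rewrite /c ringdC -cardsUI (_ : _ :&: _ = set0) ?cards0 ?addn0.
    by apply/subset_leq_card/subsetP => d; rewrite !inE => /orP[] /andP[].
  by apply/setP => d; rewrite !inE; case: (dtail d \in A); rewrite ?andbF.
have [cA9|cA9] := leqP (c A) 9.
  by have [_ [B cB BA]] := cut3_peel cA cA9; apply: (IH B) => //; exact: leq_trans BA Ak.
have cC9 : c (~: A) <= 9 by lia.
have [c9 _] := cut3_peel (cut3C cA) cC9.
by move: cAC; rewrite /c c9 -/(c A); lia.
Qed.

End CyclicCuts.

(** * Fullerenes: the faces opposite to a vertex, and resonance *)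

Section Fullerene.

Variable G : plane_graph.
Hypothesis fullG : fullerene G.
Implicit Types (d e z c : dart G) (v w : G) (A : {set G}) (X : {set dart G}).

Local Notation r := (Defs.rot G).
Local Notation phi := (face_next G).

Let connG : k_connected 3 G. Proof. by case: fullG. Qed.
Let cubicG : cubic G. Proof. by case: fullG. Qed.

Lemma fullerene_face_size d : #|face d| = 5 \/ #|face d| = 6.
Proof.
have [_ _ _ /(_ _ (face_faces d))] := fullG.
case: (boolP (face d \in pentagons G)) => [|_ /(_ isT)]; rewrite inE => /andP[_ /eqP].
  by left.
by right.
Qed.

Lemma fullerene_face_ge5 d : 5 <= #|face d|.
Proof. by case: (fullerene_face_size d) => ->. Qed.

Lemma fullerene_face_le6 d : #|face d| <= 6.
Proof. by case: (fullerene_face_size d) => ->. Qed.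

Lemma fullerene_cut3 A : #|outd A| = 3 -> #|A| <= 1 \/ #|~: A| <= 1.
Proof.
move=> A3; have := @no_cut3 G cubicG connG fullerene_face_ge5 fullerene_face_le6 A.
case: (leqP #|A| 1) => A1; first by left.
by case: (leqP #|~: A| 1) => AC1; [right | case].
Qed.

Lemma iter_face_next_inj d i j : i < 5 -> j < 5 -> iter i phi d = iter j phi d -> i = j.
Proof.
move=> i5 j5 ij; have := uniq_traject_porbit phi d; rewrite -/(face d).
move: (fullerene_face_ge5 d); case: #|_| => // n n5 u; apply/eqP.
rewrite -(nth_uniq d _ _ u) ?size_traject ?(leq_trans i5) ?(leq_trans j5) //.
by rewrite !nth_traject ?(leq_trans i5) ?(leq_trans j5) // ij.
Qed.

Lemma face_iter d i : face (iter i phi d) = face d.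
Proof. by elim: i => //= i IH; rewrite face_face_next. Qed.

(** Two faces that met would share an edge [c], and [a], [b], [c] would form a 3-edge cut. Such a
    cut consists of the edges at one vertex, but [a] and [b] have no common end on a face of length
    at least five. *)
Lemma faces_across_disjoint a : let b := phi (phi (phi a)) in
  face (drev a) != face (drev b) ->
  [disjoint face_vertices (face (drev a)) & face_vertices (face (drev b))].
Proof.
move=> b nab; apply/pred0P => w /=; apply/negP => /andP[].
move=> /imsetP[u /face_eqP ua wu] /imsetP[u' /face_eqP ub wu'].
have ab : face b = face a by rewrite /b !face_face_next.
(* At a vertex of degree three any two corners are consecutive; [c] runs along the edge between
   them. *)
have [c ca cb] : exists2 c, face c = face (drev a) & face (drev c) = face (drev b).
  have : dtail u' = dtail u by rewrite -wu -wu'.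
  case/(dtail_eqP cubicG) => uu'.
  - by case/eqP: nab; rewrite -ua -ub uu'.
  - by exists u; rewrite // -face_rot -uu'.
  - by exists (drev u'); rewrite ?drevK // -face_rot uu' rot3.
have na := face_rev_neq cubicG connG a; have nb := face_rev_neq cubicG connG b.
rewrite ab in nb.
pose s := [:: a; drev a; b; drev b; c; drev c].
have us : uniq s.
  apply: (@map_uniq _ _ (fun d => (face d, face (drev d)))).
  rewrite /= !drevK ca cb ab /= !inE !xpair_eqE.
  rewrite !eqxx ?(eq_sym (face (drev a)) (face a)) ?(eq_sym (face (drev b)) (face a)).
  by rewrite (eq_sym (face (drev b)) (face (drev a))) (negbTE na) (negbTE nb) (negbTE nab).
have [A XA] : exists A : {set G},
    forall d, (d \in [set d in s]) = (dtail d \in A) (+) (dhead d \in A).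
  apply: even_dual_is_cut => [d|f ff].
    by rewrite !inE => /or4P[|||/or3P[]] /eqP ->; rewrite ?drevK eqxx ?orbT.
  rewrite card_seq_face //= ca cb ab.
  by case: (_ == f); case: (_ == f); case: (_ == f).
have A3 : #|outd A| = 3.
  have := card_cut XA; rewrite cardsE (card_uniqP us) /=; lia.
have [w0 w0P] : exists w0, forall d, d \in s -> dtail d = w0 \/ dhead d = w0.
  have aX : a \in s by rewrite inE eqxx.
  have XA' d : d \in s -> (dtail d \in A) (+) (dhead d \in A) by rewrite -XA inE.
  have pick1 (B : {set G}) : #|B| <= 1 ->
      (forall d, d \in s -> (dtail d \in B) (+) (dhead d \in B)) ->
      exists w0, forall d, d \in s -> dtail d = w0 \/ dhead d = w0.
    move=> /card_le1_eqP B1 sB.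
    have [w0 w0B] : exists w0, w0 \in B.
      have := sB a aX; case tB: (dtail a \in B); first by exists (dtail a).
      by exists (dhead a).
    exists w0 => d /sB; case tB: (dtail d \in B); first by left; exact: B1.
    by move=> /= hB; right; exact: B1.
  case: (fullerene_cut3 A3) => A1; first exact: pick1 A1 XA'.
  apply: pick1 A1 _ => d /XA'; rewrite !inE.
  by case: (dtail d \in A); case: (dhead d \in A).
have tinj i j : i < 5 -> j < 5 -> dtail (iter i phi a) = dtail (iter j phi a) -> i = j.
  move=> i5 j5 /(face_tail_inj cubicG connG) ij; apply: (@iter_face_next_inj a) => //.
  by apply: ij; rewrite !face_iter.
have [as_ bs] : a \in s /\ b \in s by rewrite !inE !eqxx !orbT.
(* On the walk from [a], the ends of [a] have positions 0 and 1, those of [b] positions 3 and 4. *)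
case: (w0P a as_) => [|]; rewrite -?dtail_face_next => ta;
  case: (w0P b bs) => [|]; rewrite -?dtail_face_next => tb.
- by have := tinj 3 0 isT isT (etrans tb (esym ta)).
- by have := tinj 4 0 isT isT (etrans tb (esym ta)).
- by have := tinj 3 1 isT isT (etrans tb (esym ta)).
- by have := tinj 4 1 isT isT (etrans tb (esym ta)).
Qed.

(* [face (opp d)] is the face at the head of [d] that does not contain its edge. *)
Definition opp d := r (r (drev d)).

(** The face between [d] and [r d] has consecutive darts [a], [drev d], [r d], [phi (r d)]; the two
    opposite faces lie across the first and the last. *)
Lemma face_opp_disjoint d : face (opp d) != face (opp (r d)) ->
  [disjoint face_vertices (face (opp d)) & face_vertices (face (opp (r d)))].
Proof.
pose a := drev (opp d).
have a1 : phi a = drev d by rewrite face_nextE drevK /opp rot3.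
have a2 : phi (phi a) = r d by rewrite a1 face_nextE drevK.
have fb : face (drev (phi (phi (phi a)))) = face (opp (r d)).
  by rewrite a2 -face_rot face_nextE.
by have := @faces_across_disjoint a; rewrite /= fb drevK.
Qed.

Lemma perfect_matching_inj (M : {set {set G}}) d e : perfect_matching M ->
  dtail d = dtail e -> dedge d \in M -> dedge e \in M -> d = e.
Proof.
case=> _ /(_ (dtail d)) M1 de dM eM; apply: dedge_inj => //.
have /card_le1_eqP : #|[set s in M | dtail d \in s]| <= 1 by rewrite M1.
by apply; rewrite inE ?dM ?eM ?set21 //= de set21.
Qed.

Lemma perfect_matching_dart (M : {set {set G}}) v : perfect_matching M ->
  exists2 d, dtail d = v & dedge d \in M.
Proof.
case=> /subsetP ME /(_ v) M1.
have /card_gt0P[s] : 0 < #|[set s in M | v \in s]| by rewrite M1.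
rewrite inE => /andP[sM]; have /imsetP[[x y] xy sxy] := ME s sM.
have {}xy : adj x y by move: xy; rewrite inE.
pose d : dart G := exist (fun p : G * G => adj p.1 p.2) (x, y) xy.
have dM : dedge d \in M by have <- : s = dedge d := sxy.
rewrite sxy !inE => /orP[]/eqP->; first by exists d.
by exists (drev d); rewrite ?dedge_rev.
Qed.

(** An alternating face matches the head of [d] along one of its own two edges there, and the edge
    of [d] is the third. *)
Lemma alternating_opp (M : {set {set G}}) d : perfect_matching M ->
  alternating M (face (opp d)) -> dedge d \notin M.
Proof.
move=> pM altM; apply/negP; rewrite -dedge_rev => dM.
pose z := opp d; pose z' := (phi^-1)%g z.
have z'z : phi z' = z by rewrite permKV.
have z'f : z' \in face z by apply/face_eqP; rewrite -z'z face_face_next.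
have tz : dtail (drev d) = dtail z by rewrite !dtail_rot.
have := altM z' z'f; rewrite z'z; case z'M: (dedge z' \in M) => /= zM.
  have : drev d = drev z'.
    apply: (perfect_matching_inj pM) => //; last by rewrite dedge_rev.
    by rewrite tz -z'z dtail_face_next.
  move/(congr1 r); rewrite -(face_nextE z') z'z => /perm_inj /esym/eqP.
  by rewrite (negbTE (rot_neq cubicG _)).
have /esym/eqP := perfect_matching_inj pM tz dM zM.
by rewrite (negbTE (rot2_neq cubicG _)).
Qed.

(** Otherwise the three opposite faces are hexagons, pairwise equal or disjoint, and a perfect
    matching alternating on all of them would avoid every edge at [v]. *)
Lemma opp_pentagon v : k_resonant 3 G ->
  exists2 d, dtail d = v & face (opp d) \in pentagons G.
Proof.
move=> res; have [d dv] := dart_at cubicG v.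
case: (boolP [exists e : dart G, (dtail e == v) && (face (opp e) \in pentagons G)]).
  by case/existsP => e /andP[/eqP ev ep]; exists e.
move=> /existsPn nopent; exfalso.
have hex e : dtail e = v -> face (opp e) \in hexagons G.
  move=> ev; have [_ _ _ /(_ _ (face_faces _))] := fullG; apply.
  by have := nopent e; rewrite ev eqxx.
pose H := [set face (opp e) | e in [set d; r d; r (r d)]].
have Hv e : e \in [set d; r d; r (r d)] -> dtail e = v.
  by rewrite !inE -orbA => /or3P[] /eqP ->; rewrite ?dtail_rot.
have disH : disjoint_hexagons H.
  split; first by apply/subsetP => _ /imsetP[e /Hv ev ->]; exact: hex.
  have dis e e' : e' = r e -> face (opp e) != face (opp e') ->
      [disjoint face_vertices (face (opp e)) & face_vertices (face (opp e'))].
    by move=> ->; exact: face_opp_disjoint.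
  have dis' e e' : e' = r e -> face (opp e') != face (opp e) ->
      [disjoint face_vertices (face (opp e')) & face_vertices (face (opp e))].
    by move=> ee' ne; rewrite disjoint_sym dis // eq_sym.
  move=> _ _ /imsetP[e eH ->] /imsetP[e' e'H ->].
  have : dtail e' = dtail e by rewrite !Hv.
  case/(dtail_eqP cubicG) => e'e; first by rewrite e'e eqxx.
    exact: dis.
  by apply: dis'; rewrite e'e rot3.
have H3 : #|H| <= 3.
  apply: leq_trans (leq_imset_card _ _) _; apply: leq_trans (leq_card_setU _ _) _.
  by rewrite cards2 cards1; case: (_ != _).
(* Opposite faces may coincide, so resonance is applied with [i] equal to [#|H|]. *)
have [_ [M pM altM]] := res _ H H3 disH erefl.
have [e ev eM] := perfect_matching_dart v pM.
have eH : face (opp e) \in H.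
  apply: imset_f; have : dtail e = dtail d by rewrite ev.
  by case/(dtail_eqP cubicG) => ->; rewrite !inE eqxx ?orbT.
by have := alternating_opp pM (altM _ eH); rewrite eM.
Qed.

End Fullerene.

Theorem theorem4p1 (F : plane_graph) (hF : fullerene F) (hres : k_resonant 3 F) :
  #|F| <= 60.
Proof.
have [connF cubicF p12 _] := hF.
(* Each pentagon corner [z] yields one vertex: for [z = opp d] the rotation, of order three, sends
   [z] to [drev d], whose head is the tail of [d]. *)
have surj : [set: F] \subset [set dhead (Defs.rot F z) | z in cover (pentagons F)].
  apply/subsetP => v _; have [d dv dp] := opp_pentagon hF v hres.
  apply/imsetP; exists (opp d); last by rewrite /opp rot3.
  by apply/bigcupP; exists (face (opp d)) => //; exact: face_self.
rewrite -cardsT; apply: leq_trans (subset_leq_card surj) _.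
apply: leq_trans (leq_imset_card _ _) _; apply: leq_trans (leq_card_cover _) _.
rewrite (eq_bigr (fun=> 5)) => [|f]; first by rewrite sum_nat_const p12.
by rewrite inE => /andP[_ /eqP].
Qed.
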